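(* Let $(\mathcal{L},\circ_\lambda,[\cdot_\lambda\cdot])$ be a transposed Poisson conformal superalgebra (TPCSA). For any $h\in\mathcal{L}_{\bar0}$, define a new binary operation $[\cdot_\lambda\cdot]^h$ on $\mathcal{L}$ by $$[x_\lambda y]^h:=(h\circ_\mu[x_\lambda y])|_{\mu=0},\qquad\forall\,x,y\in\mathcal{L}.$$ Then $(\mathcal{L},\circ_\lambda,[\cdot_\lambda\cdot]^h)$ is a TPCSA.
   Context: All vector spaces and linear maps are over $\mathbb{C}$. A $\mathbb{Z}_2$-graded $\mathbb{C}[\partial]$-module is a $\mathbb{C}[\partial]$-module $A=A_{\bar0}\oplus A_{\bar1}$ with $\partial A_i\subseteq A_i$; $|a|$ denotes the parity of a homogeneous element $a$. Whenever $|a|$ occurs, $a$ is assumed homogeneous, and the formula is extended by linearity. $A[\lambda]$ denotes polynomials in $\lambda$ with coefficients in $A$. A conformal superalgebra $(A,\circ_\lambda)$ is a $\mathbb{Z}_2$-graded $\mathbb{C}[\partial]$-module $A$ with a $\mathbb{C}$-bilinear map $A\otimes A\to A[\lambda]$, $a\otimes b\mapsto a\circ_\lambda b$, with $A_i\circ_\lambda A_j\subseteq A_{i+j}[\lambda]$, satisfying sesquilinearity: $(\partial a)\circ_\lambda b=-\lambda\, a\circ_\lambda b$, $a\circ_\lambda(\partial b)=(\partial+\lambda)(a\circ_\lambda b)$. Products are extended polynomially in other formal variables. Substitution convention: if $a\circ_\lambda b=\sum_n\lambda^n c_n$, then $a\circ_{-\partial-\lambda}b=\sum_n(-\partial-\lambda)^nc_n$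 with $\partial$ acting on the coefficients $c_n$, and similarly for brackets. It is commutative if $a\circ_\lambda b=(-1)^{|a||b|}b\circ_{-\partial-\lambda}a$, and associative if $a\circ_\lambda(b\circ_\mu c)=(a\circ_\lambda b)\circ_{\lambda+\mu}c$, for all $a,b,c$. A Lie conformal superalgebra $(A,[\cdot_\lambda\cdot])$ is a $\mathbb{Z}_2$-graded $\mathbb{C}[\partial]$-module with a $\mathbb{C}$-bilinear map $a\otimes b\mapsto[a_\lambda b]\in A[\lambda]$, $[{A_i}_\lambda A_j]\subseteq A_{i+j}[\lambda]$, such that $[(\partial a)_\lambda b]=-\lambda[a_\lambda b]$, $[a_\lambda(\partial b)]=(\partial+\lambda)[a_\lambda b]$, $[a_\lambda b]=-(-1)^{|a||b|}[b_{-\lambda-\partial}a]$, and $[a_\lambda[b_\mu c]]=[[a_\lambda b]_{\lambda+\mu}c]+(-1)^{|a||b|}[b_\mu[a_\lambda c]]$. A transposed Poisson conformal superalgebra (TPCSA) is a $\mathbb{Z}_2$-graded $\mathbb{C}[\partial]$-module $\mathcal{L}$ with $\circ_\lambda$ and $[\cdot_\lambda\cdot]$ such that $(\mathcal{L},\circ_\lambda)$ is a commutative associative conformal superalgebra, $(\mathcal{L},[\cdot_\lambda\cdot])$ is a Lie conformal superalgebra, and $2(a\circ_\lambda[b_\mu c])=[(a\circ_\lambda b)_{\lambda+\mu}c]+(-1)^{|a||b|}[b_\mu(a\circ_\lambda c)]$ for all $a,b,c\in\mathcal{L}$. *)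

(* Defs.v *)
From HB Require Import structures.
From mathcomp Require Import all_boot all_order all_algebra.
From mathcomp Require Import boolp classical_sets functions fsbigop.
From mathcomp Require Import reals complex.
Set Implicit Arguments.
Unset Strict Implicit.
Unset Printing Implicit Defensive.
Import GRing.Theory.
Local Open Scope ring_scope.

(** * Polynomials with coefficients in a module *)

Definition finpoly {K : nzRingType} {A : lmodType K} : {pred (nat -> A)} :=
  fun u => `[< exists N : nat, forall n, (N <= n)%N -> u n = 0 >].

Lemma finpoly_submod (K : nzRingType) (A : lmodType K) :
  submod_closed (@finpoly K A).
Proof.
split=> [|c u v /asboolP[M uM] /asboolP[N vN]]; apply/asboolP; first by exists 0%N.
exists (maxn M N) => n; rewrite geq_max => /andP[Mn Nn].
by rewrite !fctE uM// vN// scaler0 addr0.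
Qed.

HB.instance Definition _ (K : nzRingType) (A : lmodType K) :=
  GRing.isSubmodClosed.Build K (nat -> A) (@finpoly K A)
    (finpoly_submod A).

(** [A[λ]], as the module of finitely supported coefficient sequences;
    it is again an [lmodType], so that [A[λ, μ]] is [mpol (mpol A)]. *)
Record mpol {K : nzRingType} (A : lmodType K) :=
  MPol { mcoef :> nat -> A; mcoefP : mcoef \in finpoly }.

HB.instance Definition _ (K : nzRingType) (A : lmodType K) :=
  [isSub for @mcoef K A].
HB.instance Definition _ (K : nzRingType) (A : lmodType K) :=
  [Choice of mpol A by <:].
HB.instance Definition _ (K : nzRingType) (A : lmodType K) :=
  [SubChoice_isSubLmodule of mpol A by <:].

Lemma mpol_eqP (K : nzRingType) (A : lmodType K) (p q : mpol A) :
  (forall n, p n = q n) <-> p = q.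
Proof. by split=> [pq|->//]; apply/val_inj/funext. Qed.

Fact mconst_subproof (K : nzRingType) (A : lmodType K) (a : A) :
  (fun n => if n is 0 then a else 0) \in finpoly.
Proof. by apply/asboolP; exists 1%N => -[]. Qed.

Definition mconst {K : nzRingType} {A : lmodType K} (a : A) : mpol A :=
  MPol (mconst_subproof a).

Fact mmulX_subproof (K : nzRingType) (A : lmodType K) (p : mpol A) :
  (fun n => if n is m.+1 then p m else 0) \in finpoly.
Proof.
have /asboolP[N pN] := mcoefP p.
by apply/asboolP; exists N.+1 => -[//|n]; exact: pN.
Qed.

(** multiplication by the variable *)
Definition mmulX {K : nzRingType} {A : lmodType K} (p : mpol A) : mpol A :=
  MPol (mmulX_subproof p).

Fact mmulX_is_linear (K : nzRingType) (A : lmodType K) :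
  linear (@mmulX K A).
Proof.
by move=> c p q; apply/mpol_eqP => -[|n] //=; rewrite !fctE scaler0 addr0.
Qed.

HB.instance Definition _ (K : nzRingType) (A : lmodType K) :=
  GRing.isLinear.Build K (mpol A) (mpol A) *:%R (@mmulX K A)
    (@mmulX_is_linear K A).

Fact mmap_subproof (K : nzRingType) (A B : lmodType K)
  (f : {linear A -> B}) (p : mpol A) : (fun n => f (p n)) \in finpoly.
Proof.
have /asboolP[N pN] := mcoefP p.
by apply/asboolP; exists N => n Nn; rewrite pN// linear0.
Qed.

Definition mmap {K : nzRingType} {A B : lmodType K} (f : {linear A -> B})
  (p : mpol A) : mpol B := MPol (mmap_subproof f p).

(** [msubst f T (\sum_n λ^n c_n) = \sum_n T^n (f c_n)]: the coefficients are
    mapped to [B] by [f], and the variable is replaced by the operator [T].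
    The sum over [setT] is a sum over the (finite) set of its nonzero terms,
    as soon as [f] and [T] are additive. *)
Definition msubst {K : nzRingType} {A B : lmodType K} (f : A -> B) (T : B -> B)
  (p : mpol A) : B := \sum_(n \in [set: nat]) iter n T (f (p n)).

(** ** The operators λ, μ and λ + μ on A[λ, μ] = A[λ][μ] *)

Definition lam {K : nzRingType} {A : lmodType K} : mpol (mpol A) -> mpol (mpol A) :=
  mmap (@mmulX K A).
Definition mu {K : nzRingType} {A : lmodType K} : mpol (mpol A) -> mpol (mpol A) :=
  mmulX.
Definition lam_mu {K : nzRingType} {A : lmodType K} (P : mpol (mpol A)) :
  mpol (mpol A) := lam P + mu P.

(** [opat op T a b] is [a op_T b] in [A[λ, μ]], for [T] one of the above. *)
Definition opat {K : nzRingType} {A : lmodType K} (op : A -> A -> mpol A)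
    (T : mpol (mpol A) -> mpol (mpol A)) (a b : A) : mpol (mpol A) :=
  msubst (fun c => mconst (mconst c)) T (op a b).

(** [a op1_S (b op2_T c)] and [(a op2_S b) op1_T c], where the outer product
    [op1] is extended polynomially in the variable of the inner one. *)
Definition opr {K : nzRingType} {A : lmodType K} (op1 op2 : A -> A -> mpol A)
    (S T : mpol (mpol A) -> mpol (mpol A)) (a b c : A) : mpol (mpol A) :=
  msubst (fun x => opat op1 S a x) T (op2 b c).
Definition opl {K : nzRingType} {A : lmodType K} (op1 op2 : A -> A -> mpol A)
    (S T : mpol (mpol A) -> mpol (mpol A)) (a b c : A) : mpol (mpol A) :=
  msubst (fun x => opat op1 T x c) S (op2 a b).

(** [(-∂-λ) p] for [p] in [A[λ]], and [a op_{-∂-λ} b] *)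
Definition mskew {K : nzRingType} {A : lmodType K} (D : {linear A -> A})
  (p : mpol A) : mpol A := - mmap D p - mmulX p.
Definition opskew {K : nzRingType} {A : lmodType K} (D : {linear A -> A})
    (op : A -> A -> mpol A) (a b : A) : mpol A :=
  msubst mconst (mskew D) (op a b).

(** * Conformal superalgebras *)

(** A [K[∂]]-module is a [K]-module [A] with an endomorphism [D]. A grading is a
    pair of subspaces [gr false] (even) and [gr true] (odd); parities add by
    [(+)] and multiply by [&&]. *)
Record is_Z2graded {K : nzRingType} {A : lmodType K} (D : {linear A -> A})
    (gr : bool -> {pred A}) : Prop := IsZ2Graded {
  gr_submod : forall i, submod_closed (gr i);
  gr_sum : forall a, exists2 a0, a0 \in gr false &
             exists2 a1, a1 \in gr true & a = a0 + a1;
  gr_direct : forall a, a \in gr false -> a \in gr true -> a = 0;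
  gr_stable : forall i a, a \in gr i -> D a \in gr i }.

Record is_conformal {K : nzRingType} {A : lmodType K} (D : {linear A -> A})
    (gr : bool -> {pred A}) (op : A -> A -> mpol A) : Prop := IsConformal {
  cf_graded : is_Z2graded D gr;
  cf_linearl : forall b, linear (fun a => op a b);
  cf_linearr : forall a, linear (op a);
  cf_parity : forall i j a b, a \in gr i -> b \in gr j ->
                forall n, op a b n \in gr (i (+) j);
  cf_sesquil : forall a b, op (D a) b = - mmulX (op a b);
  cf_sesquir : forall a b, op a (D b) = mmap D (op a b) + mmulX (op a b) }.

Definition conf_commutative {K : nzRingType} {A : lmodType K}
    (D : {linear A -> A}) (gr : bool -> {pred A}) (op : A -> A -> mpol A) : Prop :=
  forall i j a b, a \in gr i -> b \in gr j ->
    op a b = (-1) ^+ (i && j) *: opskew D op b a.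

Definition conf_associative {K : nzRingType} {A : lmodType K}
    (op : A -> A -> mpol A) : Prop :=
  forall a b c, opr op op lam mu a b c = opl op op lam lam_mu a b c.

Definition conf_skewsymmetric {K : nzRingType} {A : lmodType K}
    (D : {linear A -> A}) (gr : bool -> {pred A}) (br : A -> A -> mpol A) : Prop :=
  forall i j a b, a \in gr i -> b \in gr j ->
    br a b = - ((-1) ^+ (i && j) *: opskew D br b a).

Definition conf_jacobi {K : nzRingType} {A : lmodType K}
    (gr : bool -> {pred A}) (br : A -> A -> mpol A) : Prop :=
  forall i j a b c, a \in gr i -> b \in gr j ->
    opr br br lam mu a b c =
      opl br br lam lam_mu a b c + (-1) ^+ (i && j) *: opr br br mu lam b a c.

Record is_Lie_conformal {K : nzRingType} {A : lmodType K} (D : {linear A -> A})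
    (gr : bool -> {pred A}) (br : A -> A -> mpol A) : Prop := IsLieConformal {
  lie_conformal : is_conformal D gr br;
  lie_skew : conf_skewsymmetric D gr br;
  lie_jacobi : conf_jacobi gr br }.

Record is_TPCSA {K : nzRingType} {A : lmodType K} (D : {linear A -> A})
    (gr : bool -> {pred A}) (circ br : A -> A -> mpol A) : Prop := IsTPCSA {
  tp_conformal : is_conformal D gr circ;
  tp_commutative : conf_commutative D gr circ;
  tp_associative : conf_associative circ;
  tp_lie : is_Lie_conformal D gr br;
  tp_compat : forall i j a b c, a \in gr i -> b \in gr j ->
    2 *: opr circ br lam mu a b c =
      opl br circ lam lam_mu a b c
      + (-1) ^+ (i && j) *: opr br circ mu lam b a c }.

(** [(h circ_μ [x_λ y])|_{μ = 0}]; the evaluation at [μ = 0] is the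
    substitution of the zero operator for the outer variable. *)
Definition hbracket {K : nzRingType} {A : lmodType K} (circ br : A -> A -> mpol A)
    (h x y : A) : mpol A :=
  msubst id (fun=> 0) (opr circ br mu lam h x y).

(* Main.v *)
Require Import Defs.
From HB Require Import structures.
From mathcomp Require Import all_boot all_order all_algebra.
From mathcomp Require Import boolp classical_sets functions fsbigop.
From mathcomp Require Import reals complex.
Set Implicit Arguments.
Unset Strict Implicit.
Unset Printing Implicit Defensive.
Import GRing.Theory.
Local Open Scope ring_scope.

(** With [H x := (h circ_mu x)|_{mu = 0}], the new bracket is [H] applied to the
    coefficients of the old one. [H] is even, commutes with [D], and
    [a circ (H x) = H (a circ x)], because
    [a circ_lambda h = h circ_{-D-lambda} a] and [D] acts as [-lambda] on the left
    factor. Compatibility at [lambda = 0] reads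
    [2 H [b c] = [(H b) c] + [b (H c)]]. Adding the Jacobi identities of
    [(H a, b, c)], [(a, H b, c)], [(a, b, H c)] and subtracting twice [H] of the
    one of [(a, b, c)] leaves
    [[a H [b c]] = [H [a b] c] + (-1)^(|a||b|) [b H [a c]]]; applying [H] is the
    Jacobi identity of the new bracket. *)

(** * Linear structure on constants, coefficients, and the operators λ, μ, λ + μ, -∂-λ *)

Definition coef0 {K : nzRingType} {A : lmodType K} (p : mpol A) : A := p 0%N.

Section LinearInstances.
Variables (K : nzRingType).

Fact mconst_is_linear (A : lmodType K) : linear (@mconst K A).
Proof.
by move=> c p q; apply/mpol_eqP => -[|n] //=; rewrite !fctE scaler0 addr0.
Qed.

HB.instance Definition _ (A : lmodType K) :=
  GRing.isLinear.Build K A (mpol A) *:%R (@mconst K A) (@mconst_is_linear A).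

Fact mmap_is_linear (A B : lmodType K) (f : {linear A -> B}) :
  linear (mmap f).
Proof. by move=> c p q; apply/mpol_eqP => n /=; rewrite !fctE linearP. Qed.

HB.instance Definition _ (A B : lmodType K) (f : {linear A -> B}) :=
  GRing.isLinear.Build K (mpol A) (mpol B) *:%R (mmap f) (@mmap_is_linear A B f).

Fact coef0_is_linear (A : lmodType K) : linear (@coef0 K A).
Proof. by []. Qed.

HB.instance Definition _ (A : lmodType K) :=
  GRing.isLinear.Build K (mpol A) A *:%R (@coef0 K A) (@coef0_is_linear A).

HB.instance Definition _ (A : lmodType K) :=
  GRing.Linear.copy (@lam K A) (mmap (@mmulX K A)).

HB.instance Definition _ (A : lmodType K) :=
  GRing.Linear.copy (@mu K A) (@mmulX K (mpol A)).

Fact lam_mu_is_linear (A : lmodType K) : linear (@lam_mu K A).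
Proof. by move=> c p q; rewrite /lam_mu !linearP scalerDr addrACA. Qed.

HB.instance Definition _ (A : lmodType K) :=
  GRing.isLinear.Build K (mpol (mpol A)) (mpol (mpol A)) *:%R (@lam_mu K A)
    (@lam_mu_is_linear A).

Fact mskew_is_linear (A : lmodType K) (D : {linear A -> A}) : linear (mskew D).
Proof.
move=> c p q; rewrite /mskew (linearP (mmap D)) (linearP (@mmulX K A)).
by rewrite !opprD scalerDr !scalerN addrACA.
Qed.

HB.instance Definition _ (A : lmodType K) (D : {linear A -> A}) :=
  GRing.isLinear.Build K (mpol A) (mpol A) *:%R (mskew D) (@mskew_is_linear A D).

End LinearInstances.

(** * Calculus of substitution into polynomials *)

Section Substitution.
Local Open Scope classical_set_scope.
Variable K : nzRingType.

(** The maps fed to [msubst] are mostly plain functions such as [op^~ b], known to be linear only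
    through a proof; hence these unbundled forms. *)
Lemma linear_image0 (A B : lmodType K) (f : A -> B) : linear f -> f 0 = 0.
Proof.
by move=> lf; have := lf (-1) 0 0; rewrite scaler0 addr0 scaleN1r addNr.
Qed.

Lemma linear_imageD (A B : lmodType K) (f : A -> B) :
  linear f -> forall x y, f (x + y) = f x + f y.
Proof. by move=> lf x y; rewrite -[x]scale1r lf !scale1r. Qed.

Lemma linear_bundle (A B : lmodType K) (f : A -> B) :
  linear f -> exists g : {linear A -> B}, g =1 f.
Proof.
move=> lf; pose M := GRing.isLinear.Build K A B *:%R f lf.
pose g : {linear A -> B} := HB.pack f M.
by exists g.
Qed.

Lemma mpol_bound (A : lmodType K) (p : mpol A) :
  exists N : nat, forall n, (N <= n)%N -> p n = 0.
Proof. by have /asboolP := mcoefP p. Qed.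

Lemma iter_linear (B : lmodType K) (T : {linear B -> B}) n : linear (iter n T).
Proof. by elim: n => [|n IH] c x y //=; rewrite IH linearP. Qed.

Lemma fsum_ord (B : lmodType K) (F : nat -> B) (N : nat) :
  (forall n, (N <= n)%N -> F n = 0) ->
  \sum_(n \in [set: nat]) F n = \sum_(n < N) F n.
Proof.
move=> FN; rewrite fsbig_ord -(fsbig_widen `I_N setT) // => n [_ /negP].
by rewrite -leqNgt => /FN.
Qed.

(** Any bound [N] on the degree is allowed, so that several polynomials can be summed over one
    common range. *)
Lemma msubst_sum (A B : lmodType K) (f : A -> B) (T : {linear B -> B})
    (p : mpol A) (N : nat) :
  f 0 = 0 -> (forall n, (N <= n)%N -> p n = 0) ->
  msubst f T p = \sum_(n < N) iter n T (f (p n)).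
Proof.
move=> f0 pN; apply: fsum_ord => n /pN ->.
by rewrite f0 (linear_image0 (iter_linear _ _)).
Qed.

Lemma msubst_linear (A B : lmodType K) (f : A -> B) (T : {linear B -> B}) :
  linear f -> linear (msubst f T).
Proof.
move=> lf c p q; have f0 := linear_image0 lf.
have [M pM] := mpol_bound p; have [N qN] := mpol_bound q.
have pMN n : (maxn M N <= n)%N -> p n = 0.
  by rewrite geq_max => /andP[/pM].
have qMN n : (maxn M N <= n)%N -> q n = 0.
  by rewrite geq_max => /andP[_ /qN].
have rMN n : (maxn M N <= n)%N -> (c *: p + q) n = 0.
  by move=> MNn; rewrite /= !fctE pMN // qMN // scaler0 addr0.
rewrite (msubst_sum _ f0 pMN) (msubst_sum _ f0 qMN) (msubst_sum _ f0 rMN).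
rewrite scaler_sumr -big_split; apply: eq_bigr => n _ /=.
by rewrite !fctE lf (iter_linear T).
Qed.

Lemma msubst_add_fun (A B : lmodType K) (f g : A -> B) (T : {linear B -> B})
    (p : mpol A) : linear f -> linear g ->
  msubst (fun x => f x + g x) T p = msubst f T p + msubst g T p.
Proof.
move=> lf lg; have [N pN] := mpol_bound p.
have [f0 g0] := (linear_image0 lf, linear_image0 lg).
rewrite (msubst_sum _ f0 pN) (msubst_sum _ g0 pN) (msubst_sum _ _ pN) /=; last first.
  by rewrite f0 g0 addr0.
rewrite -big_split; apply: eq_bigr => n _.
by rewrite (linear_imageD (iter_linear T n)).
Qed.

(** The main tool: a linear map that intertwines [T] with [T'] passes through the substitution. It
    serves for evaluations at 0, for [H] applied to coefficients, and for substitutions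
    themselves. *)
Lemma linear_msubst (A B C : lmodType K) (f : A -> B) (T : {linear B -> B})
    (phi : {linear B -> C}) (T' : {linear C -> C}) (p : mpol A) :
  linear f -> (forall x, phi (T x) = T' (phi x)) ->
  phi (msubst f T p) = msubst (phi \o f) T' p.
Proof.
move=> lf phiT; have f0 := linear_image0 lf; have [N pN] := mpol_bound p.
rewrite (msubst_sum _ f0 pN) (msubst_sum _ _ pN) /= ?f0 ?linear0 //.
rewrite linear_sum; apply: eq_bigr => n _ /=.
by elim: (n : nat) (f _) => //= k IH x; rewrite phiT IH.
Qed.

Lemma eq_msubst (A B : lmodType K) (f g : A -> B) (T : B -> B) (p : mpol A) :
  f =1 g -> msubst f T p = msubst g T p.
Proof. by move=> /funext ->. Qed.

Lemma msubst_mmap (A B C : lmodType K) (f : B -> C) (g : {linear A -> B})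
    (T : C -> C) (p : mpol A) :
  msubst f T (mmap g p) = msubst (fun x => f (g x)) T p.
Proof. by []. Qed.

Lemma msubst_mmulX (A B : lmodType K) (f : A -> B) (T : {linear B -> B})
    (p : mpol A) : linear f -> msubst f T (mmulX p) = T (msubst f T p).
Proof.
move=> lf; have f0 := linear_image0 lf; have [N pN] := mpol_bound p.
(* The degree bound moves up by one; the new zeroth term is [f 0]. *)
rewrite (@msubst_sum _ _ _ _ _ N.+1) //; last by case.
rewrite (@msubst_sum _ _ _ _ _ N) // big_ord_recl /= f0 add0r.
by rewrite linear_sum.
Qed.

Lemma msubst_mconst (A B : lmodType K) (f : A -> B) (T : {linear B -> B}) (a : A) :
  linear f -> msubst f T (mconst a) = f a.
Proof.
move=> lf; rewrite (@msubst_sum _ _ _ _ _ 1) ?(linear_image0 lf) //; last by case.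
by rewrite big_ord1.
Qed.

Lemma msubst_0 (A B : lmodType K) (f : A -> B) (p : mpol A) :
  linear f -> msubst f (fun=> 0) p = f (coef0 p).
Proof.
move=> lf; have f0 := linear_image0 lf; have [N pN] := mpol_bound p.
(* The range [N.+1] is nonempty, so the zeroth term, on which the zero operator is iterated 0 times,
   can be split off. *)
have pN1 n : (N.+1 <= n)%N -> p n = 0 by move/ltnW/pN.
rewrite (@msubst_sum _ _ _ (\0 : {linear B -> B}) _ N.+1) // big_ord_recl /=.
by rewrite big1 ?addr0.
Qed.

Lemma msubst_mconst_mmulX (A : lmodType K) (p : mpol A) :
  msubst mconst mmulX p = p.
Proof.
have iterE n (a : A) m : iter n mmulX (mconst a) m = if m == n then a else 0.
  by elim: n m => [|n IH] [|m] //=; rewrite IH eqSS.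
have coefS N (F : nat -> mpol A) m : (\sum_(n < N) F n) m = \sum_(n < N) F n m.
  elim: N => [|N IH]; first by rewrite !big_ord0.
  by rewrite !big_ord_recr /= -IH.
apply/mpol_eqP => m; have [N pN] := mpol_bound p.
(* This bound also exceeds [m], so that the [m]-th term occurs in the sum. *)
have pN1 n : (N + m.+1 <= n)%N -> p n = 0.
  by move=> Nn; apply: pN; apply: leq_trans Nn; rewrite leq_addr.
rewrite (@msubst_sum _ _ _ _ _ (N + m.+1)) //; last exact: linear0.
rewrite (coefS _ (fun n => iter n mmulX (mconst (p n)))).
have mN : (m < N + m.+1)%N by rewrite addnS ltnS leq_addl.
rewrite (bigD1 (Ordinal mN)) //= iterE eqxx big1 ?addr0 // => i im.
by rewrite iterE eq_sym; case: eqP => // e; case/eqP: im; apply: val_inj.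
Qed.

Lemma msubst_mconst_linear (A B : lmodType K) (f : {linear A -> B}) (p : mpol A) :
  msubst (fun x => mconst (f x)) mmulX p = mmap f p.
Proof. exact: msubst_mconst_mmulX (mmap f p). Qed.

End Substitution.

(** * Nested products evaluated at λ = 0 or at μ = 0 *)

Definition is_bilinear {K : nzRingType} {A : lmodType K} (op : A -> A -> mpol A) :=
  (forall b, linear (op^~ b)) /\ (forall a, linear (op a)).

Section Products.
Variables (K : nzRingType) (A : lmodType K).
Implicit Types (op : A -> A -> mpol A) (S T : {linear mpol (mpol A) -> mpol (mpol A)}).

Fact mconst2_linear : linear (fun c : A => mconst (mconst c)).
Proof. by move=> c x y; rewrite !linearP. Qed.

Lemma opat_linearr op S a : is_bilinear op -> linear (opat op S a).
Proof. by case=> _ lr c x y; rewrite /opat lr (msubst_linear S mconst2_linear). Qed.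

Lemma linear_opat (C : lmodType K) (phi : {linear mpol (mpol A) -> C}) op S
    (S' : {linear C -> C}) a b : (forall x, phi (S x) = S' (phi x)) ->
  phi (opat op S a b) = msubst (fun c => phi (mconst (mconst c))) S' (op a b).
Proof. exact: linear_msubst mconst2_linear. Qed.

Lemma linear_opr (C : lmodType K) (phi : {linear mpol (mpol A) -> C}) op1 op2 S T
    (T' : {linear C -> C}) a b c :
  is_bilinear op1 -> (forall x, phi (T x) = T' (phi x)) ->
  phi (opr op1 op2 S T a b c) = msubst (fun x => phi (opat op1 S a x)) T' (op2 b c).
Proof. by move=> bil1; apply: linear_msubst (opat_linearr S a bil1). Qed.

Lemma is_bilinear_flip op : is_bilinear op -> is_bilinear (fun a b => op b a).
Proof. by case. Qed.

(** A left-nested product is a right-nested one for the flipped outer product, with the two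
    operators exchanged; results on [opr] thus carry over. *)
Lemma opl_opr op1 op2 (S T : mpol (mpol A) -> mpol (mpol A)) a b c :
  opl op1 op2 S T a b c = opr (fun x y => op1 y x) op2 T S c a b.
Proof. by []. Qed.

(** In A[λ][μ] the outer variable is μ: [mmap coef0] sets λ = 0, while [coef0] sets μ = 0. Under
    either one, each operator becomes zero or multiplication by the remaining variable. *)
Notation lam0 := (mmap (@coef0 K A)).

Let lam0_lam (P : mpol (mpol A)) : lam0 (lam P) = (\0 : {linear mpol A -> mpol A}) (lam0 P).
Proof. by apply/mpol_eqP. Qed.

Let lam0_mu (P : mpol (mpol A)) : lam0 (mu P) = mmulX (lam0 P).
Proof. by apply/mpol_eqP => -[]. Qed.

Let lam0_lam_mu (P : mpol (mpol A)) : lam0 (lam_mu P) = mmulX (lam0 P).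
Proof. by rewrite /lam_mu linearD /= lam0_mu lam0_lam add0r. Qed.

Let mu0_lam (P : mpol (mpol A)) : coef0 (lam P) = mmulX (coef0 P).
Proof. by []. Qed.

Let mu0_mu (P : mpol (mpol A)) : coef0 (mu P) = (\0 : {linear mpol A -> mpol A}) (coef0 P).
Proof. by []. Qed.

Let mu0_lam_mu (P : mpol (mpol A)) : coef0 (lam_mu P) = mmulX (coef0 P).
Proof. by exact: addr0. Qed.

Let lam0_mconst2 (c : A) : lam0 (mconst (mconst c)) = mconst c.
Proof. by apply/mpol_eqP => -[]. Qed.

Lemma lam0_opat_lam op a b : lam0 (opat op lam a b) = mconst (coef0 (op a b)).
Proof.
rewrite (linear_opat _ _ _ lam0_lam) (eq_msubst _ _ lam0_mconst2).
exact: msubst_0 (mconst_is_linear (A := A)).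
Qed.

Lemma lam0_opat_mu op a b : lam0 (opat op mu a b) = op a b.
Proof.
rewrite (linear_opat _ _ _ lam0_mu) (eq_msubst _ _ lam0_mconst2).
exact: msubst_mconst_mmulX.
Qed.

Lemma lam0_opat_lam_mu op a b : lam0 (opat op lam_mu a b) = op a b.
Proof.
rewrite (linear_opat _ _ _ lam0_lam_mu) (eq_msubst _ _ lam0_mconst2).
exact: msubst_mconst_mmulX.
Qed.

Lemma mu0_opat_lam op a b : coef0 (opat op lam a b) = op a b.
Proof. by rewrite (linear_opat _ _ _ mu0_lam); exact: msubst_mconst_mmulX. Qed.

Lemma mu0_opat_mu op a b : coef0 (opat op mu a b) = mconst (coef0 (op a b)).
Proof.
rewrite (linear_opat _ _ _ mu0_mu).
exact: msubst_0 (mconst_is_linear (A := A)).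
Qed.

Lemma mu0_opat_lam_mu op a b : coef0 (opat op lam_mu a b) = op a b.
Proof. by rewrite (linear_opat _ _ _ mu0_lam_mu); exact: msubst_mconst_mmulX. Qed.

Section Evaluation.
Variables (op1 op2 : A -> A -> mpol A) (bil1 : is_bilinear op1).

Lemma lam0_opr_lam_mu (H : {linear A -> A}) a b c :
  (forall x, H x = coef0 (op1 a x)) ->
  lam0 (opr op1 op2 lam mu a b c) = mmap H (op2 b c).
Proof.
move=> HE; rewrite (linear_opr _ _ _ _ _ bil1 lam0_mu) -msubst_mconst_linear.
by apply: eq_msubst => x; rewrite /= lam0_opat_lam HE.
Qed.

Lemma lam0_opr_mu_lam a b c :
  lam0 (opr op1 op2 mu lam a b c) = op1 a (coef0 (op2 b c)).
Proof.
rewrite (linear_opr _ _ _ _ _ bil1 lam0_lam) (eq_msubst _ _ (lam0_opat_mu _ _)).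
by rewrite msubst_0 //; case: bil1.
Qed.

Lemma lam0_opl_lam_lam_mu a b c :
  lam0 (opl op1 op2 lam lam_mu a b c) = op1 (coef0 (op2 a b)) c.
Proof.
rewrite opl_opr (linear_opr _ _ _ _ _ (is_bilinear_flip bil1) lam0_lam).
rewrite (eq_msubst _ _ (lam0_opat_lam_mu _ _)) msubst_0 //.
by case: bil1.
Qed.

Lemma mu0_opr_mu_lam (H : {linear A -> A}) a b c :
  (forall x, H x = coef0 (op1 a x)) ->
  coef0 (opr op1 op2 mu lam a b c) = mmap H (op2 b c).
Proof.
move=> HE; rewrite (linear_opr _ _ _ _ _ bil1 mu0_lam) -msubst_mconst_linear.
by apply: eq_msubst => x; rewrite /= mu0_opat_mu HE.
Qed.

Lemma mu0_opr_lam_mu a b c :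
  coef0 (opr op1 op2 lam mu a b c) = op1 a (coef0 (op2 b c)).
Proof.
rewrite (linear_opr _ _ _ _ _ bil1 mu0_mu) (eq_msubst _ _ (mu0_opat_lam _ _)).
by rewrite msubst_0 //; case: bil1.
Qed.

(** At μ = 0 the inner λ and the outer λ + μ become the same variable, so all coefficients of the
    inner product contribute. *)
Lemma mu0_opl_lam_lam_mu a b c :
  coef0 (opl op1 op2 lam lam_mu a b c) = msubst (op1^~ c) mmulX (op2 a b).
Proof.
rewrite opl_opr (linear_opr _ _ _ _ _ (is_bilinear_flip bil1) mu0_lam).
by rewrite (eq_msubst _ _ (mu0_opat_lam_mu _ _)).
Qed.

End Evaluation.

End Products.

(** * Composing a product with an endomorphism; half-derivations *)

Definition postcomp {K : nzRingType} {A : lmodType K} (H : {linear A -> A})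
    (op : A -> A -> mpol A) (a b : A) : mpol A := mmap H (op a b).

(** The conformal form of a 1/2-derivation, doubled to avoid dividing by 2. No sign appears, since
    it is meant for even [H]. *)
Definition half_derivation {K : nzRingType} {A : lmodType K} (H : {linear A -> A})
    (op : A -> A -> mpol A) : Prop :=
  forall b c, mmap H (op b c) *+ 2 = op (H b) c + op b (H c).

Section PostComposition.
Variables (K : nzRingType) (A : lmodType K) (H : {linear A -> A}).
Implicit Types (op br : A -> A -> mpol A) (D : {linear A -> A}).
Implicit Types (gr : bool -> {pred A}).

Notation HH := (mmap (mmap H)).

Lemma mmap_mmulX (B : lmodType K) (f : {linear B -> B}) (p : mpol B) :
  mmap f (mmulX p) = mmulX (mmap f p).
Proof. by apply/mpol_eqP => -[|n] //=; rewrite linear0. Qed.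

Lemma mmap2_lam (P : mpol (mpol A)) : HH (lam P) = lam (HH P).
Proof. by apply/mpol_eqP => n /=; rewrite mmap_mmulX. Qed.

Lemma mmap2_mu (P : mpol (mpol A)) : HH (mu P) = mu (HH P).
Proof. exact: mmap_mmulX. Qed.

Lemma mmap2_lam_mu (P : mpol (mpol A)) : HH (lam_mu P) = lam_mu (HH P).
Proof. by rewrite /lam_mu linearD /= mmap2_lam mmap2_mu. Qed.

Section Operators.
Variables S T : {linear mpol (mpol A) -> mpol (mpol A)}.
Hypotheses (HS : forall P, HH (S P) = S (HH P)) (HT : forall P, HH (T P) = T (HH P)).

Lemma opat_postcomp op a b : opat (postcomp H op) S a b = HH (opat op S a b).
Proof.
rewrite (linear_opat _ _ _ HS) /opat msubst_mmap; apply: eq_msubst => c.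
by apply/mpol_eqP => -[|n]; apply/mpol_eqP => -[|m] //=; rewrite linear0.
Qed.

Lemma opr_postcomp op1 op2 a b c : is_bilinear op1 ->
  opr (postcomp H op1) op2 S T a b c = HH (opr op1 op2 S T a b c).
Proof.
move=> bil1; rewrite (linear_opr _ _ _ _ _ bil1 HT).
by apply: eq_msubst => x; exact: opat_postcomp.
Qed.

(** The rule used on the inner product: 2 a(H(bc)) = a((Hb)c) + a(b(Hc)). *)
Lemma opr_half_derivation_inner op1 op2 a b c :
  is_bilinear op1 -> half_derivation H op2 ->
  opr op1 (postcomp H op2) S T a b c *+ 2 =
    opr op1 op2 S T a (H b) c + opr op1 op2 S T a b (H c).
Proof.
move=> bil1 half2.
have addF := linear_imageD (msubst_linear T (opat_linearr S a bil1)).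
by rewrite mulr2n /opr -!addF /postcomp -half2 mulr2n.
Qed.

(** The rule used on the outer product: 2 H(a(bc)) = (Ha)(bc) + a(H(bc)). *)
Lemma opr_half_derivation_outer op1 op2 a b c :
  is_bilinear op1 -> half_derivation H op1 ->
  HH (opr op1 op2 S T a b c) *+ 2 =
    opr op1 op2 S T (H a) b c + opr op1 (postcomp H op2) S T a b c.
Proof.
move=> bil1 half1; have lopat x := opat_linearr S x bil1.
rewrite (linear_opr _ _ _ _ _ bil1 HT) mulr2n.
have lHopat : linear (fun x => HH (opat op1 S a x)).
  by move=> k x y; rewrite (lopat a) linearP.
have lopatH : linear (fun x => opat op1 S a (H x)).
  by move=> k x y; rewrite linearP (lopat a).
rewrite -msubst_add_fun // /opr msubst_mmap -msubst_add_fun //.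
apply: eq_msubst => x; rewrite /= -!opat_postcomp /opat.
have ladd := linear_imageD (msubst_linear S (@mconst2_linear K A)).
by rewrite -!ladd /postcomp -half1 mulr2n.
Qed.

End Operators.

Lemma half_derivation_flip op :
  half_derivation H op -> half_derivation H (fun a b => op b a).
Proof. by move=> half b c; rewrite half addrC. Qed.

Lemma half_derivation_jacobi gr br :
  is_bilinear br -> half_derivation H br ->
  (forall i a, a \in gr i -> H a \in gr i) ->
  conf_jacobi gr br -> conf_jacobi gr (postcomp H br).
Proof.
move=> bil half Hgr jac i j a b c ai bj.
have bilf := is_bilinear_flip bil; have halff := half_derivation_flip half.
rewrite opl_opr (opr_postcomp mmap2_lam mmap2_mu) //.
rewrite (opr_postcomp mmap2_mu mmap2_lam) //.
rewrite (opr_postcomp (op1 := fun x y => br y x) mmap2_lam_mu mmap2_lam) //.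
(* All three terms carry an outer [H]; the identity is proved already before it is applied. *)
rewrite -linearZ -linearD; congr (HH _).
set s := _ ^+ _; set P := opr _ _ lam mu a b c.
set Q := opr _ _ mu lam b a c; set L := opr _ _ lam_mu lam c a b.
pose r x y z := opr br br lam mu x y z.
pose q x y z := opr br br mu lam x y z.
pose l x y z := opr (fun x y => br y x) br lam_mu lam x y z.
have jacr i' j' x y z : x \in gr i' -> y \in gr j' ->
    r x y z = l z x y + (-1) ^+ (i' && j') *: q y x z by exact: jac.
have outP : HH (r a b c) *+ 2 = r (H a) b c + P.
  exact (opr_half_derivation_outer mmap2_lam mmap2_mu br a b c bil half).
have outQ : HH (q b a c) *+ 2 = q (H b) a c + Q.
  exact (opr_half_derivation_outer mmap2_mu mmap2_lam br b a c bil half).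
have outL : HH (l c a b) *+ 2 = l (H c) a b + L.
  exact (opr_half_derivation_outer mmap2_lam_mu mmap2_lam br c a b bilf halff).
have inP : P *+ 2 = r a (H b) c + r a b (H c).
  exact (opr_half_derivation_inner lam mu a b c bil half).
have inQ : Q *+ 2 = q b (H a) c + q b a (H c).
  exact (opr_half_derivation_inner mu lam b a c bil half).
have inL : L *+ 2 = l c (H a) b + l c a (H b).
  exact (opr_half_derivation_inner lam_mu lam c a b bilf half).
(* The added term is 2 H of [a [b c]] by [outP]. On the right it is kept in that form and expanded
   by Jacobi for (a, b, c); on the left it combines with [P] into [r (H a) b c + P *+ 2], that is,
   [a [b c]] with [H] put in each of the three slots. *)
apply: (addIr (r (H a) b c + P)).
rewrite -{2}outP (jacr i j a b c) // linearD linearZ mulrnDl scalerMnr /= outL outQ.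
(* Jacobi on each of the three; [H] preserves parity, so the sign is always [s]. What follows only
   reorders the sums. *)
rewrite addrCA -mulr2n inP (jacr i j) ?Hgr // (jacr i j a) ?Hgr // (jacr i j a b) //.
rewrite -/s scalerDr [RHS]addrACA [L + _]addrCA [s *: Q + _]addrCA -scalerDr.
rewrite -!mulr2n inL inQ scalerDr.
rewrite [X in _ + X = _]addrACA [LHS]addrACA.
rewrite [l (H c) a b + _]addrC -[_ + _ + l (H c) a b]addrA.
by rewrite [s *: q (H b) a c + (_ + _)]addrCA.
Qed.

Lemma mskew_mmap D p : (forall x, H (D x) = D (H x)) ->
  mmap H (mskew D p) = mskew D (mmap H p).
Proof.
move=> HD; rewrite /mskew linearB linearN /= mmap_mmulX.
by congr (- _ - _); apply/mpol_eqP => n /=.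
Qed.

Lemma postcomp_skew D gr br : (forall x, H (D x) = D (H x)) ->
  conf_skewsymmetric D gr br -> conf_skewsymmetric D gr (postcomp H br).
Proof.
move=> HD skew i j a b ai bj; rewrite /postcomp (skew i j a b ai bj) linearN linearZ.
congr (- (_ *: _)).
have mskewH p := mskew_mmap p HD.
rewrite /opskew (linear_msubst _ (mconst_is_linear (A := A)) mskewH) msubst_mmap.
by apply: eq_msubst => x; apply/mpol_eqP => -[|n] //=; rewrite linear0.
Qed.

Lemma postcomp_conformal D gr br : (forall x, H (D x) = D (H x)) ->
  (forall i a, a \in gr i -> H a \in gr i) ->
  is_conformal D gr br -> is_conformal D gr (postcomp H br).
Proof.
move=> HD Hgr [grd ll lr par sesl sesr]; rewrite /postcomp; split => //.
- by move=> b c x y; rewrite ll linearP.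
- by move=> b c x y; rewrite lr linearP.
- by move=> i j a b ai bj n /=; apply: Hgr; exact: par.
- by move=> a b; rewrite sesl linearN /= mmap_mmulX.
- move=> a b; rewrite sesr linearD /= mmap_mmulX; congr (_ + _).
  by apply/mpol_eqP => n /=.
Qed.

End PostComposition.

Lemma hbracketE (K : nzRingType) (A : lmodType K) (circ br : A -> A -> mpol A) (h : A)
    (H : {linear A -> A}) :
  is_bilinear circ -> (forall x, H x = coef0 (circ h x)) ->
  hbracket circ br h = postcomp H br.
Proof.
move=> bil HE; apply/funext => x; apply/funext => y.
by rewrite /hbracket msubst_0 // (mu0_opr_mu_lam _ bil _ _ HE).
Qed.

(** * Multiplication by an even element at parameter 0 *)

Section EvenMultiplication.
Variables (K : nzRingType) (A : lmodType K) (D : {linear A -> A}).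
Variables (gr : bool -> {pred A}) (circ : A -> A -> mpol A).
Hypotheses (conf : is_conformal D gr circ) (comm : conf_commutative D gr circ).
Hypothesis assoc : conf_associative circ.
Variables (h : A) (H : {linear A -> A}).
Hypotheses (h_even : h \in gr false) (HE : forall x, H x = coef0 (circ h x)).

Lemma conformal_bilinear (op : A -> A -> mpol A) :
  is_conformal D gr op -> is_bilinear op.
Proof. by case. Qed.

Let bil := conformal_bilinear conf.

(** Right sesquilinearity gives the factor ∂ + μ, which is ∂ at μ = 0. *)
Lemma even_mul_D x : H (D x) = D (H x).
Proof. by rewrite !HE (cf_sesquir conf) linearD /= /coef0 /= addr0. Qed.

Lemma even_mul_gr i a : a \in gr i -> H a \in gr i.
Proof. by move=> ai; rewrite HE; exact: (cf_parity conf h_even ai). Qed.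

(** In the left factor of a product with parameter λ, ∂ acts as -λ, so -∂-λ acts as zero. *)
Lemma msubst_mul_skew x p :
  msubst (circ^~ x) mmulX (mskew D p) = 0.
Proof.
have lcirc : linear (circ^~ x) := bil.1 x.
have addF := linear_imageD (msubst_linear (@mmulX K A) lcirc).
have F0 := linear_image0 (msubst_linear (@mmulX K A) lcirc).
set F := msubst _ _ in addF F0 *.
have cancelF : F (mmap D p + mmulX p) = 0.
  (* Multiplication by λ is moved inside, next to each coefficient, where it cancels against ∂ term
     by term. *)
  have FX : F (mmulX p) = msubst (fun z => mmulX (circ z x)) mmulX p.
    by rewrite /F msubst_mmulX // (linear_msubst (phi := mmulX) (T' := mmulX)).
  have FD : F (mmap D p) = msubst (fun z => circ (D z) x) mmulX p by [].
  rewrite addF FX FD -msubst_add_fun; first last.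
  - by move=> c y z; rewrite (bil.1 x) linearP.
  - by move=> c y z; rewrite linearP (bil.1 x).
  have zero y : circ (D y) x + mmulX (circ y x) = (\0 : {linear A -> mpol A}) y.
    by rewrite (cf_sesquil conf) addNr.
  have [N pN] := mpol_bound p.
  rewrite (eq_msubst _ _ zero) (msubst_sum _ _ pN) // big1 // => n _.
  exact: (linear_image0 (iter_linear _ _)).
rewrite -[LHS]addr0 -{1}cancelF -addF (_ : mskew D p + _ = 0) ?F0 //.
by rewrite /mskew -opprD addNr.
Qed.

(** The left side is (a ∘_λ h) ∘_λ x. Commutativity expands a ∘_λ h in powers of -∂-λ; all positive
    powers die by [msubst_mul_skew], leaving the constant term [H a]. *)
Lemma msubst_mul_comm i a x : a \in gr i ->
  msubst (circ^~ x) mmulX (circ a h) = circ (H a) x.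
Proof.
move=> ai; rewrite (comm ai h_even) andbF expr0 scale1r /opskew.
have [F FE] := linear_bundle (msubst_linear (@mmulX K A) (bil.1 x)).
(* [F] intertwines -∂-λ with the zero operator, hence [T' := \0]. *)
rewrite -FE (linear_msubst (T := mskew D) (T' := \0) _ (mconst_is_linear (A := A))).
  rewrite msubst_0 /=; last by move=> c y z; rewrite /= !linearP.
  by rewrite FE msubst_mconst ?HE //; exact: bil.1.
by move=> p; rewrite FE msubst_mul_skew.
Qed.

(** Both sides equal (H a) ∘ x: the left by associativity of (a, h, x) at μ = 0, the right by that
    of (h, a, x) at λ = 0. *)
Lemma mul_even_mul i a x : a \in gr i -> circ a (H x) = mmap H (circ a x).
Proof.
move=> ai; have := congr1 coef0 (assoc a h x).
rewrite (mu0_opr_lam_mu _ bil) (mu0_opl_lam_lam_mu _ bil) -HE (msubst_mul_comm _ ai) => ->.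
have := congr1 (mmap coef0) (assoc h a x).
by rewrite (lam0_opr_lam_mu _ bil _ _ HE) (lam0_opl_lam_lam_mu _ bil) -HE.
Qed.

End EvenMultiplication.

Theorem proposition4p1 (R : realType) (L : lmodType R[i])
    (D : {linear L -> L}) (gr : bool -> {pred L})
    (circ br : L -> L -> mpol L)
    (HL : is_TPCSA D gr circ br) (h : L) (hh : h \in gr false) :
  is_TPCSA D gr circ (hbracket circ br h).
Proof.
have [conf comm assoc [bconf skew jac] compat] := HL.
have bilc := conformal_bilinear conf; have bilb := conformal_bilinear bconf.
have [H HE] : exists H : {linear L -> L}, forall x, H x = coef0 (circ h x).
  by apply: linear_bundle => c x y; rewrite (bilc.2 h) linearP.
have HD := even_mul_D conf HE; have Hgr := even_mul_gr conf hh HE.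
rewrite (hbracketE _ bilc HE).
(* Compatibility of (h, b, c) at λ = 0; the sign is trivial because [h] is even. *)
have half_hom i b c : b \in gr i -> mmap H (br b c) *+ 2 = br (H b) c + br b (H c).
  move=> bi; have := congr1 (mmap coef0) (compat _ _ h b c hh bi).
  rewrite /= expr0 scale1r scaler_nat mulr2n !linearD /= (lam0_opr_lam_mu _ bilc _ _ HE).
  by rewrite (lam0_opl_lam_lam_mu _ bilb) (lam0_opr_mu_lam _ bilb) -!HE -mulr2n.
have half : half_derivation H br.
  (* Compatibility speaks of homogeneous [b], so [b] is split into its even and odd parts. *)
  move=> b c; have [b0 b0gr [b1 b1gr ->]] := gr_sum (cf_graded conf) b.
  have addbr x := linear_imageD (bilb.1 x).
  rewrite linearD !addbr linearD mulrnDl (half_hom _ _ _ b0gr) (half_hom _ _ _ b1gr).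
  by rewrite addrACA.
split => //.
  split; first exact: postcomp_conformal.
  - exact: postcomp_skew.
  - exact: half_derivation_jacobi.
(* Compatibility of the new bracket: on the right [H] comes out and leaves the old law; on the left
   it is moved out past the product with [a] by [mul_even_mul]. *)
move=> i j a b c ai bj.
have bilf := is_bilinear_flip bilb.
rewrite opl_opr.
rewrite (opr_postcomp (op1 := fun x y => br y x) (mmap2_lam_mu H) (mmap2_lam H)) //.
rewrite (opr_postcomp (mmap2_mu H) (mmap2_lam H)) //.
rewrite -linearZ -linearD -opl_opr -(compat i j a b c ai bj) linearZ; congr (_ *: _).
rewrite /= -(opr_postcomp (mmap2_lam H) (mmap2_mu H)) //.
apply: (eq_msubst (f := fun x => opat circ lam a (H x))) => x.
by rewrite /opat /postcomp (mul_even_mul conf comm assoc hh HE x ai).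
Qed.
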